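(* Let $(\mathbb{R}^{2m},\varphi,\langle\cdot,\cdot\rangle)$ be a para-Kähler-Norden real Euclidean space and let $T^{\varphi}_{1}\mathbb{R}^{2m}$ be its $\varphi$-unit tangent bundle equipped with the $\varphi$-Sasaki metric. Any naturally parameterized oblique geodesic $\Gamma=(\gamma(t),\xi(t))$ on $T^{\varphi}_{1}\mathbb{R}^{2m}$ is of the form $$\gamma(t)=c_1t+c_2,\qquad \xi(t)=c_3\cos(\rho t)+c_4\sin(\rho t),$$ where $\rho$ is a constant with $0<\rho<1$ and $c_1,c_2,c_3,c_4\in\mathbb{R}^{2m}$ are constant vectors.
   Context: A para-Kähler-Norden manifold $(M^{2m},\varphi,g)$ is a $2m$-dimensional Riemannian manifold $(M,g)$ with a $(1,1)$-tensor field $\varphi$ such that $\varphi^2=\mathrm{id}$, $\varphi\ne\pm\mathrm{id}$, the $+1$ and $-1$ eigenbundles of $\varphi$ have equal rank, $g(\varphi X,Y)=g(X,\varphi Y)$, and $\nabla\varphi=0$, where $\nabla$ is the Levi-Civita connection of $g$. Here $M=\mathbb{R}^{2m}$ and $g=\langle\cdot,\cdot\rangle$ is the standard Euclidean metric; $|\cdot|$ is its norm. Points of $TM$ are written $(x,\xi)$; ${}^{H}X$, ${}^{V}X$ are the horizontal (with respect to $\nabla$) and vertical lifts to $TM$. The $\varphi$-Sasaki metric $g^\varphi$ on $TM$ is defined by $g^\varphi({}^HX,{}^HY)=g(X,Y)$, $g^\varphi({}^HX,{}^VY)=0$, $g^\varphi({}^VX,{}^VY)=g(X,\varphi Y)$.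 The $\varphi$-unit tangent bundle is the hypersurface $T^{\varphi}_{1}M=\{(x,\xi)\in TM: g(\xi,\varphi\xi)=1\}$, equipped with the metric induced by $g^\varphi$; $\widehat\nabla$ is the Levi-Civita connection of this induced metric. A curve $\Gamma=(\gamma(t),\xi(t))$ consists of a curve $\gamma$ on $M$ and a vector field $\xi$ along $\gamma$. Write $\gamma_t'=d\gamma/dt$, $\xi_t'=\nabla_{\gamma_t'}\xi$; then $\Gamma_t'={}^H\gamma_t'+{}^V\xi_t'$. $\Gamma$ is naturally parameterized if $t$ is an arc length parameter, i.e. $g^\varphi(\Gamma_t',\Gamma_t')=|\gamma_t'|^2+g(\xi_t',\varphi\xi_t')=1$. $\Gamma$ is a geodesic on $T^\varphi_1M$ if $\widehat\nabla_{\Gamma_t'}\Gamma_t'=0$. A naturally parameterized geodesic is called oblique if $|\gamma_t'|=\sqrt{1-\rho^2}$ and $g(\xi_t',\varphi\xi_t')=\rho^2$ for a constant $\rho$ with $0<\rho<1$; this is the $\rho$ of the claim. *)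

(* Defs.v *)
(* MathComp-Analysis: everything is over an arbitrary R : realType. *)
From HB Require Import structures.
From mathcomp Require Import all_boot all_order all_algebra.
From mathcomp Require Import all_classical all_reals all_analysis.

Set Implicit Arguments.
Unset Strict Implicit.
Unset Printing Implicit Defensive.

Import Order.TTheory GRing.Theory Num.Theory.
Import numFieldNormedType.Exports.
Local Open Scope classical_set_scope.
Local Open Scope ring_scope.

Section Smoothness.
Variables (R : realType) (V W : normedModType R).

(* C^k on an open set A.  C^(k+1) means: differentiable on A, with all
   directional derivatives C^k on A; for finite-dimensional V this is the usual
   C^(k+1).  For curves take V := R^o. *)
Fixpoint Ck_on (k : nat) (A : set V) (f : V -> W) : Prop :=
  match k with
  | 0 => forall x, A x -> {for x, continuous f}
  | k'.+1 => (forall x, A x -> differentiable f x) /\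
             (forall v : V, Ck_on k' A (fun x => 'D_v f x))
  end.

Definition smooth_on (A : set V) (f : V -> W) : Prop :=
  forall k, Ck_on k A f.

End Smoothness.

(* The Levi-Civita connection of a (pseudo-Riemannian) metric, in coordinates:
   h u is the Gram matrix of the metric in the coordinate frame at the point u
   of an open subset of R^k. *)
Section LeviCivita.
Variables (R : realType) (k : nat).

Definition coord_vec (i : 'I_k) : 'rV[R]_k := delta_mx 0 i.

(* Gamma^l_(ij) =
     1/2 sum_s h^(ls) (d_i h_(js) + d_j h_(is) - d_s h_(ij)). *)
Definition christoffel (h : 'rV[R]_k -> 'M[R]_k) (u : 'rV[R]_k)
    (l i j : 'I_k) : R :=
  2^-1 * \sum_s invmx (h u) l s *
    ('D_(coord_vec i) (fun w => h w j s : R^o) u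
     + 'D_(coord_vec j) (fun w => h w i s : R^o) u
     - 'D_(coord_vec s) (fun w => h w i j : R^o) u).

(* Covariant derivative at time t, along the curve c, of the vector field Y
   along c. *)
Definition cov_deriv_along (h : 'rV[R]_k -> 'M[R]_k) (c Y : R -> 'rV[R]_k)
    (t : R) : 'rV[R]_k :=
  derive1 Y t +
  \row_l \sum_i \sum_j christoffel h (c t) l i j * derive1 c t 0 i * Y t 0 j.

End LeviCivita.

(* Submanifolds of a normed space E carrying a field G of bilinear forms. *)
Section Submanifold.
Variables (R : realType) (E : normedModType R) (k : nat).

(* F is a smooth injective immersion of the open set U of R^k into S.  When S is
   a k-dimensional embedded submanifold, F is a diffeomorphism of U onto an open
   subset of S. *)
Definition local_parametrization (S : set E) (U : set 'rV[R]_k)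
    (F : 'rV[R]_k -> E) : Prop :=
  [/\ open U,
      smooth_on U F,
      forall u, U u -> S (F u),
      forall u v, U u -> U v -> F u = F v -> u = v &
      forall u, U u -> injective ('d F u)].

Definition induced_metric (G : E -> E -> E -> R) (F : 'rV[R]_k -> E)
    (u : 'rV[R]_k) : 'M[R]_k :=
  \matrix_(i, j) G (F u) ('D_(coord_vec R i) F u) ('D_(coord_vec R j) F u).

(* Gam : I -> S is a geodesic of the metric induced by G on the k-dimensional
   submanifold S of E: around every parameter, Gam is read in a local
   parametrization as a smooth curve c with vanishing covariant acceleration.
   The Levi-Civita connection does not depend on the coordinates, so neither
   does this condition depend on the choice of the parametrization. *)
Definition geodesic_on (G : E -> E -> E -> R) (S : set E) (I : set R)
    (Gam : R -> E) : Prop :=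
  forall t0, I t0 ->
  exists (U : set 'rV[R]_k) (F : 'rV[R]_k -> E)
         (J : set R) (c : R -> 'rV[R]_k),
    [/\ local_parametrization S U F,
        [/\ open J, J t0 & J `<=` I],
        smooth_on (J : set R^o) c,
        forall t, J t -> U (c t) /\ Gam t = F (c t) &
        forall t, J t ->
          cov_deriv_along (induced_metric G F) c (derive1 c) t = 0].

End Submanifold.
Arguments geodesic_on {R E} k G S I Gam.

Section ParaKahlerNorden.
Variable R : realType.

Definition dot n (u v : 'rV[R]_n) : R := \sum_i u 0 i * v 0 i.
Definition enorm n (u : 'rV[R]_n) : R := Num.sqrt (dot u u).

(* The Levi-Civita connection of the Euclidean metric is the flat one. *)
Definition euclidean_nabla n (X Y : 'rV[R]_n -> 'rV[R]_n) (x : 'rV[R]_n) :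
    'rV[R]_n :=
  'D_(X x) Y x.

(* A (1,1)-tensor field phi is a matrix field acting on row vectors:
   (phi X)(x) = X x *m phi x. *)
Definition tensor_app n (phi : 'rV[R]_n -> 'M[R]_n) (X : 'rV[R]_n -> 'rV[R]_n) :
    'rV[R]_n -> 'rV[R]_n :=
  fun x => X x *m phi x.

(* nabla phi = 0, where
   (nabla_X phi) Y = nabla_X (phi Y) - phi (nabla_X Y). *)
Definition parallel_tensor n (phi : 'rV[R]_n -> 'M[R]_n) : Prop :=
  forall X Y : 'rV[R]_n -> 'rV[R]_n, smooth_on setT X -> smooth_on setT Y ->
  forall x, euclidean_nabla X (tensor_app phi Y) x
            - tensor_app phi (euclidean_nabla X Y) x = 0.

Record para_kahler_norden m (phi : 'rV[R]_(2 * m) -> 'M[R]_(2 * m)) : Prop := {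
  pkn_smooth : smooth_on setT phi;
  pkn_involutive : forall x, phi x *m phi x = 1%:M;
  pkn_neq_id : phi <> (fun=> 1%:M);
  pkn_neq_opp_id : phi <> (fun=> - 1%:M);
  pkn_equal_rank : forall x,
    \rank (eigenspace (phi x) 1) = \rank (eigenspace (phi x) (-1));
  pkn_pure : forall x X Y, dot (X *m phi x) Y = dot X (Y *m phi x);
  pkn_parallel : parallel_tensor phi
}.

(* TR^n = R^n x R^n.  As the connection is flat, the horizontal and vertical
   lifts to a point (x, xi) of a vector X are (X, 0) and (0, X), so a tangent
   vector (A1, A2) of TR^n is the horizontal lift of A1 plus the vertical lift
   of A2. *)
Definition tanb n : normedModType R := ('rV[R]_n * 'rV[R]_n)%type.

Definition sasaki n (phi : 'rV[R]_n -> 'M[R]_n) (p A B : tanb n) : R :=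
  dot A.1 B.1 + dot A.2 (B.2 *m phi p.1).

Definition phi_unit_bundle n (phi : 'rV[R]_n -> 'M[R]_n) : set (tanb n) :=
  [set p | dot p.2 (p.2 *m phi p.1) = 1].

(* Below, derive1 xi is the covariant derivative of xi along gam, so
   (derive1 gam t, derive1 xi t) is the velocity of (gam, xi). *)
Definition naturally_parametrized n (phi : 'rV[R]_n -> 'M[R]_n) (I : set R)
    (gam xi : R -> 'rV[R]_n) : Prop :=
  forall t, I t ->
    sasaki phi (gam t, xi t) (derive1 gam t, derive1 xi t)
      (derive1 gam t, derive1 xi t) = 1.

Definition unit_bundle_geodesic m (phi : 'rV[R]_(2 * m) -> 'M[R]_(2 * m))
    (I : set R) (gam xi : R -> 'rV[R]_(2 * m)) : Prop :=
  [/\ smooth_on (I : set R^o) gam,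
      smooth_on (I : set R^o) xi,
      forall t, I t -> phi_unit_bundle phi (gam t, xi t) &
      geodesic_on (4 * m).-1 (sasaki phi) (phi_unit_bundle phi) I
        (fun t => (gam t, xi t) : tanb (2 * m))].

Definition oblique n (phi : 'rV[R]_n -> 'M[R]_n) (I : set R) (rho : R)
    (gam xi : R -> 'rV[R]_n) : Prop :=
  0 < rho < 1 /\
  forall t, I t ->
    enorm (derive1 gam t) = Num.sqrt (1 - rho ^+ 2) /\
    dot (derive1 xi t) (derive1 xi t *m phi (gam t)) = rho ^+ 2.

End ParaKahlerNorden.

(* Main.v *)
(* As phi is parallel and the connection is flat, phi is a constant symmetric
   involution P, so g^phi is a constant nondegenerate bilinear form on R^(4m),
   and N = (0, xi) is a unit normal of the hypersurface <xi, P xi> = 1.  In a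
   local parametrization the geodesic equation says that the ambient
   acceleration (gamma'', xi'') is orthogonal to every tangent vector, hence a
   multiple of N: gamma'' = 0 and xi'' = lambda xi.  Differentiating
   <xi, P xi> = 1 twice gives lambda = - <xi', P xi'> = - rho^2. *)
Require Import Defs.
From HB Require Import structures.
From mathcomp Require Import all_boot all_order all_algebra.
From mathcomp Require Import all_classical all_reals all_analysis.
From mathcomp Require Import ring lra zify.

Set Implicit Arguments.
Unset Strict Implicit.
Unset Printing Implicit Defensive.

Import Order.TTheory GRing.Theory Num.Theory.
Import numFieldNormedType.Exports.
Local Open Scope classical_set_scope.
Local Open Scope ring_scope.

(** * Directional derivatives, mean value arguments and symmetry of second derivatives *)

Section Calculus.
Variable R : realType.

(** Difference quotients commute with [L], and continuity carries the limit through; only the one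
    directional derivative of [f] has to exist. *)
Lemma is_derive_linear (V W W' : normedModType R) (L : {linear W -> W'})
    (f : V -> W) x v df :
  continuous L -> is_derive x v f df -> is_derive x v (L \o f) (L df).
Proof.
move=> cL [dfx <-].
have H : (fun h => h^-1 *: (((L \o f) \o shift x) (h *: v) - (L \o f) x)) @ 0^'
    --> L ('D_v f x).
  rewrite [X in X @ _](_ : _ =
    L \o (fun h => h^-1 *: ((f \o shift x) (h *: v) - f x))); last first.
    by apply/funext => h /=; rewrite linearZ_LR (linearB L).
  by apply: continuous_cvg; [exact: cL | exact: dfx].
by apply: DeriveDef; [apply/cvg_ex; eexists; exact: H | exact: cvg_lim H].
Qed.

Lemma is_derive_fst (V : normedModType R) n (F : V -> tanb R n) x v dF :
  is_derive x v F dF -> is_derive x v (fun y => (F y).1) dF.1.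
Proof.
by move=> dFx; apply: (is_derive_linear (L := fst)) => // z; exact: cvg_fst.
Qed.

Lemma is_derive_snd (V : normedModType R) n (F : V -> tanb R n) x v dF :
  is_derive x v F dF -> is_derive x v (fun y => (F y).2) dF.2.
Proof.
by move=> dFx; apply: (is_derive_linear (L := snd)) => // z; exact: cvg_snd.
Qed.

Lemma is_derive_pair (V : normedModType R) n (f g : V -> 'rV[R]_n) x v
    (df dg : 'rV[R]_n) :
  is_derive x v f df -> is_derive x v g dg ->
  is_derive x v (fun y => (f y, g y) : tanb R n) (df, dg).
Proof.
move=> [dfx <-] [dgx <-].
have H : (fun h => h^-1 *: (((fun y => (f y, g y) : tanb R n) \o shift x) (h *: v)
    - (f x, g x))) @ 0^' --> (('D_v f x, 'D_v g x) : tanb R n).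
  rewrite [X in X @ _](_ : _ = fun h => (h^-1 *: ((f \o shift x) (h *: v) - f x),
    h^-1 *: ((g \o shift x) (h *: v) - g x)))//.
  exact: (cvg_pair dfx dgx).
by apply: DeriveDef; [apply/cvg_ex; eexists; exact: H | exact: cvg_lim H].
Qed.

Lemma is_derive_derive1 (V : normedModType R) (I : set R) (f : R -> V) t :
  smooth_on (I : set R^o) f -> I t -> is_derive t 1 f (derive1 f t).
Proof.
move=> sf It; rewrite derive1E; apply/derivableP/diff_derivable.
exact: (sf 1%N).1.
Qed.

Lemma is_derive_derive2 (V : normedModType R) (I : set R) (f : R -> V) t :
  smooth_on (I : set R^o) f -> I t ->
  is_derive t 1 (derive1 f) (derive1 (derive1 f) t).
Proof.
move=> sf It; rewrite (derive1E (derive1 f)); apply/derivableP.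
rewrite (_ : derive1 f = fun s : R^o => 'D_1 f s); last first.
  by apply/funext => s; rewrite derive1E.
by apply: diff_derivable; exact: ((sf 2%N).2 _).1.
Qed.

Lemma is_derive_mxE (V : normedModType R) m n (M : V -> 'M[R]_(m, n)) x v
    (dM : 'M[R]_(m, n)) i j :
  is_derive x v M dM -> is_derive x v (fun y => M y i j : R^o) (dM i j).
Proof.
move=> [Mx <-]; rewrite derive_mx// mxE.
by apply: DeriveDef => //; exact: ((derivable_mxP M x v).1 Mx).
Qed.

Lemma is_derive_mx (V : normedModType R) m n (M : V -> 'M[R]_(m, n)) x v
    (dM : 'M[R]_(m, n)) :
  (forall i j, is_derive x v (fun y => M y i j : R^o) (dM i j)) ->
  is_derive x v M dM.
Proof.
move=> Mij; have Mx : derivable M x v.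
  by apply/derivable_mxP => i j; case: (Mij i j).
apply: DeriveDef => //; rewrite derive_mx//.
by apply/matrixP => i j; rewrite mxE; case: (Mij i j).
Qed.

Lemma is_derive_sum_fct (V : normedModType R) n (h : 'I_n -> V -> R^o) x v
    (dh : 'I_n -> R) :
  (forall i, is_derive x v (h i) (dh i)) ->
  is_derive x v (fun y => \sum_(i < n) h i y : R^o) (\sum_(i < n) dh i).
Proof.
move=> dhx; rewrite [X in is_derive _ _ X](_ : _ = \sum_(i < n) h i).
  exact: is_derive_sum.
by apply/funext => y; rewrite fct_sumE.
Qed.

Lemma is_derive_mul (V : normedModType R) (f g : V -> R^o) x v (df dg : R) :
  is_derive x v f df -> is_derive x v g dg ->
  is_derive x v (fun y => f y * g y : R^o) (df * g x + f x * dg).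
Proof.
move=> dfx dgx; apply: (is_derive_eq (is_deriveM dfx dgx)).
by rewrite /GRing.scale /= addrC mulrC [df * _]mulrC [_ * dg]mulrC mulrC.
Qed.

Lemma is_derive_dot (V : normedModType R) n (X Y : V -> 'rV[R]_n) x v
    (dX dY : 'rV[R]_n) :
  is_derive x v X dX -> is_derive x v Y dY ->
  is_derive x v (fun y => dot (X y) (Y y) : R^o)
    (dot dX (Y x) + dot (X x) dY).
Proof.
move=> dXx dYx; rewrite /dot -big_split/=.
by apply: is_derive_sum_fct => i; apply: is_derive_mul; exact: is_derive_mxE.
Qed.

Lemma is_derive_mulmx (V : normedModType R) m n (X : V -> 'rV[R]_m)
    (P : 'M[R]_(m, n)) x v (dX : 'rV[R]_m) :
  is_derive x v X dX -> is_derive x v (fun y => X y *m P) (dX *m P).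
Proof.
move=> dXx; apply: is_derive_mx => i j.
rewrite [X in is_derive _ _ X](_ : _ =
  (fun y => \sum_k X y i k * cst (P k j) y : R^o)); last first.
  by apply/funext => y; rewrite mxE.
rewrite mxE; apply: is_derive_sum_fct => k.
apply: (is_derive_eq (is_derive_mul (is_derive_mxE i k dXx)
  (is_derive_cst _ _ _))).
by rewrite mulr0 addr0.
Qed.

(** Reduces directional derivatives to one real variable, where the mean value theorem lives: the
    two difference quotients are the same function of [h]. *)
Lemma is_derive_line (V W : normedModType R) (f : V -> W) x v (s : R) df :
  is_derive (x + s *: v) v f df ->
  is_derive s 1 (fun s : R => f (x + s *: v)) df.
Proof.
have E : (fun h : R => h^-1 *: (((fun s : R => f (x + s *: v)) \o shift s) (h *: 1)
    - f (x + s *: v))) = (fun h => h^-1 *: ((f \o shift (x + s *: v)) (h *: v)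
    - f (x + s *: v))).
  apply/funext => h /=; congr (_ *: (f _ - _)).
  by rewrite [h *: 1]mulr1 scalerDl addrCA.
by move=> [d <-]; apply: DeriveDef; rewrite /derivable /derive E.
Qed.

Lemma is_derive_curve (V W : normedModType R) (F : V -> W) (c : R -> V) t dc :
  differentiable F (c t) -> is_derive t 1 c dc ->
  is_derive t 1 (F \o c) ('D_dc F (c t)).
Proof.
move=> dF [dct <-]; have dct' : differentiable c t by apply/derivable1_diffP.
have dFc : differentiable (F \o c) t by apply: differentiable_comp.
apply: DeriveDef; first exact/diff_derivable.
by rewrite deriveE// diff_comp//= !deriveE.
Qed.

Lemma derive_basis k (W : normedModType R) (F : 'rV[R]_k -> W) x v :
  differentiable F x -> 'D_v F x = \sum_i v 0 i *: 'D_(coord_vec R i) F x.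
Proof.
move=> dF; rewrite deriveE// {1}(row_sum_delta v) linear_sum.
by apply: eq_bigr => i _; rewrite linearZ deriveE.
Qed.

Lemma MVT_is_derive (f df : R -> R) (a b : R) : a <= b ->
  (forall x, x \in `[a, b]%R -> is_derive x 1 (f : R -> R^o) (df x)) ->
  exists2 c, c \in `[a, b]%R & f b - f a = df c * (b - a).
Proof.
move=> ab dfx.
have dfoo x : x \in `]a, b[%R -> is_derive x 1 f (df x).
  by move=> xab; apply: dfx; exact: subset_itv_oo_cc xab.
have cf : {within `[a, b], continuous f}.
  by apply: (@derivable_within_continuous R R^o f) => x xab; case: (dfx x xab).
exact: MVT_segment ab dfoo cf.
Qed.

(** The mean value theorem is applied to each entry, since as an equality it fails for vector
    values. That [I] is an interval keeps the segment from [s] to [t] inside it. *)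
Lemma is_derive0_itv_cst m n (I : set R) (f : R -> 'M[R]_(m, n)) : is_interval I ->
  (forall t, I t -> is_derive t 1 f 0) ->
  forall s t, I s -> I t -> f s = f t.
Proof.
move=> hI f0; suff H s t : s <= t -> I s -> I t -> f s = f t.
  by move=> s t Is It; have [/H|/ltW/H] := leP s t; [exact|move=> ->].
move=> st Is It; apply/matrixP => i j.
have [//|c _] := @MVT_is_derive (fun u => f u i j) (fun=> 0) s t st.
  move=> u; rewrite in_itv/= => sut; apply: (is_derive_eq (is_derive_mxE i j _)).
    by apply: f0; apply: hI sut.
  by rewrite mxE.
by rewrite mul0r => /eqP; rewrite subr_eq0 => /eqP.
Qed.

(* Two applications of the mean value theorem to the second difference. *)
Lemma second_difference_MVT (V : normedModType R) (f fv fvw : V -> R^o) x v w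
    (t : R) : 0 <= t ->
  (forall a b, 0 <= a <= t -> 0 <= b <= t ->
    is_derive (x + a *: v + b *: w) v f (fv (x + a *: v + b *: w)) /\
    is_derive (x + a *: v + b *: w) w fv (fvw (x + a *: v + b *: w))) ->
  exists a b, [/\ 0 <= a <= t, 0 <= b <= t &
    f (x + t *: v + t *: w) - f (x + t *: v) - (f (x + t *: w) - f x)
    = t ^+ 2 * fvw (x + a *: v + b *: w)].
Proof.
move=> t0 H.
(* The second difference is [g t - g 0]. Its mean value form is [t] times the increment [dg a] of
   [fv] in direction [w], which is [k t - k 0] below. *)
pose g a := f (x + t *: w + a *: v) - f (x + a *: v).
pose dg a := fv (x + t *: w + a *: v) - fv (x + a *: v).
have dgP a : a \in `[0, t]%R -> is_derive a 1 (g : R -> R^o) (dg a).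
  rewrite in_itv/= => at0; apply: is_deriveB; apply: is_derive_line.
    by rewrite addrAC; apply: (H _ _ at0 _).1; rewrite t0 lexx.
  have := (H a 0 at0 _).1; rewrite scale0r addr0; apply.
  by rewrite t0 lexx.
have [a /[!in_itv]/= at0] := MVT_is_derive t0 dgP.
pose k b := fv (x + a *: v + b *: w).
have dkP b : b \in `[0, t]%R ->
    is_derive b 1 (k : R -> R^o) (fvw (x + a *: v + b *: w)).
  by rewrite in_itv/= => bt0; apply: is_derive_line; exact: (H _ _ at0 bt0).2.
have [b /[!in_itv]/= bt0] := MVT_is_derive t0 dkP.
rewrite /g /dg /k !scale0r !addr0 !subr0 => E2 E1; exists a, b; split=> //.
rewrite [x + _ + t *: w]addrAC E1 [x + _ + a *: v]addrAC E2; ring.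
Qed.

(** Schwarz's theorem. The second difference over a small parallelogram at [x] is symmetric in [v]
    and [w], and equals [t ^+ 2] times [fvw] at one of its points and [fwv] at another; continuity
    at [x] then identifies the two values. *)
Lemma derive_commute (V : normedModType R) (U : set V)
    (f fv fw fvw fwv : V -> R^o) x v w :
  open U -> U x ->
  (forall y, U y -> is_derive y v f (fv y)) ->
  (forall y, U y -> is_derive y w f (fw y)) ->
  (forall y, U y -> is_derive y w fv (fvw y)) ->
  (forall y, U y -> is_derive y v fw (fwv y)) ->
  {for x, continuous fvw} -> {for x, continuous fwv} -> fvw x = fwv x.
Proof.
move=> oU Ux Hv Hw Hvw Hwv cvw cwv.
apply/eqP; rewrite -subr_eq0 -normr_le0; apply/ler_addgt0Pr => e e0.
rewrite add0r.
have /nbhs_ballP[r /= r0 xr] : \forall y \near x,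
    [/\ U y, `|fvw x - fvw y| < e / 2 & `|fwv x - fwv y| < e / 2].
  near=> y; split; near: y; first exact: open_nbhs_nbhs.
    by move/cvgrPdist_lt : cvw; apply; rewrite divr_gt0.
  by move/cvgrPdist_lt : cwv; apply; rewrite divr_gt0.
have M0 : 0 < `|v| + `|w| + 1 by rewrite ltr_wpDl// addr_ge0.
(* Small enough for the whole parallelogram to lie in the ball of radius [r]; the summand 1 covers
   [v = w = 0], the half gives a strict inequality. *)
pose t := r / (`|v| + `|w| + 1) / 2.
have t0 : 0 < t by rewrite !divr_gt0.
have near_x a b : 0 <= a <= t -> 0 <= b <= t -> ball x r (x + a *: v + b *: w).
  move=> /andP[a0 at'] /andP[b0 bt].
  rewrite -ball_normE/= -addrA opprD addrA subrr add0r normrN.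
  apply: (le_lt_trans (ler_normD _ _)); rewrite !normrZ !ger0_norm//.
  have : a * `|v| + b * `|w| <= t * (`|v| + `|w| + 1).
    rewrite mulrDr mulrDr mulr1; apply: ler_wpDr; first exact: ltW.
    by apply: lerD; apply: ler_wpM2r.
  move=> /le_lt_trans; apply.
  rewrite /t mulrAC divfK ?gt_eqF//; lra.
have [a [b [a0 b0 Evw]]] : exists a b, [/\ 0 <= a <= t, 0 <= b <= t &
    f (x + t *: v + t *: w) - f (x + t *: v) - (f (x + t *: w) - f x)
    = t ^+ 2 * fvw (x + a *: v + b *: w)].
  apply: second_difference_MVT; first exact: ltW.
  by move=> a b a0 b0; have [Uy _ _] := xr _ (near_x _ _ a0 b0); split; auto.
(* The same with [v] and [w] exchanged, so the first witness [b'] is the coefficient of [w]. *)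
have [b' [a' [b'0 a'0 Ewv]]] : exists a b, [/\ 0 <= a <= t, 0 <= b <= t &
    f (x + t *: w + t *: v) - f (x + t *: w) - (f (x + t *: v) - f x)
    = t ^+ 2 * fwv (x + a *: w + b *: v)].
  apply: second_difference_MVT; first exact: ltW.
  move=> a1 b1 a10 b10; rewrite addrAC.
  by have [Uy _ _] := xr _ (near_x _ _ b10 a10); split; auto.
have E : fvw (x + a *: v + b *: w) = fwv (x + a' *: v + b' *: w).
  rewrite [in RHS]addrAC; apply: (@mulfI _ (t ^+ 2)).
    by rewrite gt_eqF// exprn_gt0.
  rewrite -Evw -Ewv [x + t *: w + t *: v]addrAC; ring.
have [_ h1 _] := xr _ (near_x _ _ a0 b0).
have [_ _ h2] := xr _ (near_x _ _ a'0 b'0).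
(* Triangle inequality through the common value [E]; each of the two parts is below [e / 2]. *)
rewrite -(subrKA (fvw (x + a *: v + b *: w))) {2}E.
apply: (le_trans (ler_normD _ _)).
rewrite [`|fwv _ - fwv x|]distrC; lra.
Unshelve. all: by end_near. Qed.

End Calculus.

(** * The constant bilinear form given by a symmetric involution *)

Section BilinearForm.
Variable R : realType.

Lemma dotE n (u v : 'rV[R]_n) : dot u v = (u *m v^T) 0 0.
Proof. by rewrite /dot mxE; apply: eq_bigr => i _; rewrite mxE. Qed.

Lemma dotC n (u v : 'rV[R]_n) : dot u v = dot v u.
Proof. by rewrite /dot; apply: eq_bigr => i _; rewrite mulrC. Qed.

Lemma dotDl n (u v w : 'rV[R]_n) : dot (u + v) w = dot u w + dot v w.
Proof. by rewrite !dotE mulmxDl mxE. Qed.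

Lemma dotZl n a (u w : 'rV[R]_n) : dot (a *: u) w = a * dot u w.
Proof. by rewrite !dotE -scalemxAl mxE. Qed.

Lemma dotr0 n (u : 'rV[R]_n) : dot u 0 = 0.
Proof. by rewrite dotE trmx0 mulmx0 mxE. Qed.

(* sasaki for the constant tensor field phi = P. *)
Definition bform n (P : 'M[R]_n) (A B : tanb R n) : R :=
  dot A.1 B.1 + dot A.2 (B.2 *m P).

Lemma bform_vertical n (P : 'M[R]_n) (A : tanb R n) (x : 'rV[R]_n) :
  bform P A (0, x) = dot A.2 (x *m P).
Proof. by rewrite /bform /= dotr0 add0r. Qed.

Lemma bformDl n (P : 'M[R]_n) (A B C : tanb R n) :
  bform P (A + B) C = bform P A C + bform P B C.
Proof. by rewrite /bform !dotDl addrACA. Qed.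

Lemma bformZl n (P : 'M[R]_n) a (A C : tanb R n) :
  bform P (a *: A) C = a * bform P A C.
Proof. by rewrite /bform !dotZl mulrDr. Qed.

Lemma bform0l n (P : 'M[R]_n) (C : tanb R n) : bform P 0 C = 0.
Proof. by rewrite -(scale0r 0) bformZl mul0r. Qed.

Lemma bform_suml n (P : 'M[R]_n) k (b : 'I_k -> tanb R n) (C : tanb R n) :
  bform P (\sum_i b i) C = \sum_i bform P (b i) C.
Proof.
by apply: (big_morph (fun A => bform P A C)) => [A B|]; rewrite (bformDl, bform0l).
Qed.

Lemma is_derive_bform n (P : 'M[R]_n) (V : normedModType R)
    (X Y : V -> tanb R n) x v (dX dY : tanb R n) :
  is_derive x v X dX -> is_derive x v Y dY ->
  is_derive x v (fun y => bform P (X y) (Y y) : R^o)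
    (bform P dX (Y x) + bform P (X x) dY).
Proof.
move=> dXx dYx; rewrite /bform addrACA; apply: is_deriveD.
  by apply: is_derive_dot; exact: is_derive_fst.
apply: is_derive_dot; first exact: is_derive_snd.
by apply: is_derive_mulmx; exact: is_derive_snd.
Qed.

(** Pairing with a fixed vector turns maps into the bundle into scalar functions, the setting of
    [derive_commute]. *)
Lemma is_derive_bforml n (P : 'M[R]_n) (V : normedModType R)
    (X : V -> tanb R n) x v (dX : tanb R n) A :
  is_derive x v X dX ->
  is_derive x v (fun y => bform P (X y) A : R^o) (bform P dX A).
Proof.
move=> dXx; have := is_derive_bform P dXx (is_derive_cst A x v).
move/is_derive_eq; apply; rewrite /=.
by rewrite {2}/bform/= mul0mx !dotr0 !addr0.
Qed.

Lemma continuous_bforml n (P : 'M[R]_n) (V : normedModType R)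
    (X : V -> tanb R n) x A :
  {for x, continuous X} -> {for x, continuous (fun y => bform P (X y) A : R^o)}.
Proof.
move=> cX.
have cdot (Y : V -> 'rV[R]_n) w : Y y @[y --> x] --> Y x ->
    dot (Y y) w @[y --> x] --> dot (Y x) w.
  move=> cY; rewrite /dot; apply: cvg_big => [|i _]; first exact: add_continuous.
  apply: (@cvgMr_tmp R).
  exact: (continuous_cvg _ (@coord_continuous _ _ _ 0 i _) cY).
apply: (@cvgD R R^o).
  by apply: cdot; apply: (continuous_cvg _ _ cX); exact: cvg_fst.
by apply: cdot; apply: (continuous_cvg _ _ cX); exact: cvg_snd.
Qed.

(** * Frames consisting of a unit normal and a free tangent family *)

Section Frame.
Variables (n k : nat) (P : 'M[R]_n).
Hypothesis PP : P *m P = 1%:M.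
Hypothesis Psym : forall X Y, dot (X *m P) Y = dot X (Y *m P).
Hypothesis dim : k.+1 = (n + n)%N.
Variables (N : tanb R n) (a : 'I_k -> tanb R n).
Hypothesis NN : bform P N N = 1.
Hypothesis aN : forall i, bform P (a i) N = 0.
Hypothesis a_free : forall b : 'rV_k, \sum_i b 0 i *: a i = 0 -> b = 0.

Lemma bformC (A B : tanb R n) : bform P A B = bform P B A.
Proof. by rewrite /bform dotC -Psym [in X in _ + X]dotC. Qed.

(** Pairs become single rows, so that spanning can be expressed by matrix rank. *)
Let pack (A : tanb R n) : 'rV[R]_(n + n) := row_mx A.1 A.2.

Let bform_pack A B : bform P A B = (pack A *m (pack (B.1, B.2 *m P))^T) 0 0.
Proof. by rewrite /pack /bform tr_row_mx mul_row_col mxE !dotE. Qed.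

Let packD A B : pack (A + B) = pack A + pack B.
Proof. by rewrite /pack add_row_mx. Qed.

Let packZ c A : pack (c *: A) = c *: pack A.
Proof. by rewrite /pack scale_row_mx. Qed.

Let pack_inj A B : pack A = pack B -> A = B.
Proof. by case: A B => [A1 A2] [B1 B2] /eq_row_mx[/= -> ->]. Qed.

Let frame_mx : 'M[R]_(1 + k, n + n) := col_mx (pack N) (\matrix_i pack (a i)).

Let mul_frame_mx (v : 'rV_(1 + k)) :
  v *m frame_mx = pack (lsubmx v 0 0 *: N + \sum_i rsubmx v 0 i *: a i).
Proof.
rewrite -[v in LHS]hsubmxK mul_row_col [rsubmx v *m _]mulmx_sum_row.
rewrite packD packZ; congr (_ + _).
  by rewrite [X in X *m _]mx11_scalar mul_scalar_mx.
have pack0 : pack 0 = 0 by rewrite -(scale0r 0) packZ scale0r.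
rewrite (big_morph pack packD pack0).
by apply: eq_bigr => i _; rewrite rowK packZ.
Qed.

(** Pairing a linear relation among the rows with [N] leaves only the coefficient of [N], which must
    vanish; [a_free] kills the others. By [dim] the independent rows are as many as the columns,
    hence they span. *)
Let frame_mx_full : row_full frame_mx.
Proof.
suff : row_free frame_mx.
  by rewrite /row_free /row_full => /eqP ->; apply/eqP; exact: dim.
apply: inj_row_free => v; rewrite mul_frame_mx -[RHS](_ : pack 0 = _); last first.
  by rewrite -(scale0r 0) packZ scale0r.
move=> /pack_inj E.
have l0 : lsubmx v 0 0 = 0.
  have := bform0l P N; rewrite -E bformDl bformZl NN mulr1 bform_suml big1 ?addr0//.
  by move=> i _; rewrite bformZl aN mulr0.
move: E; rewrite l0 scale0r add0r => /a_free r0.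
by rewrite -[v]hsubmxK r0 [lsubmx v]mx11_scalar l0 raddf0 row_mx0.
Qed.

(** The form need not be definite, so a spanning family is used: orthogonality to it forces
    [(w.1, w.2 *m P)] to vanish, and [P] is invertible. *)
Lemma frame_nondegenerate (w : tanb R n) :
  bform P w N = 0 -> (forall i, bform P w (a i) = 0) -> w = 0.
Proof.
move=> wN wa; pose x := (pack (w.1, w.2 *m P))^T.
have : frame_mx *m x = frame_mx *m 0.
  rewrite mulmx0; apply/row_matrixP => i; rewrite row_mul row0.
  apply/rowP => j; rewrite ord1 [RHS]mxE.
  case: (split_ordP i) => i' ->.
    by rewrite ord1 rowKu row_id -bform_pack bformC.
  by rewrite rowKd rowK -bform_pack bformC.
move/(row_full_inj frame_mx_full)/(congr1 trmx); rewrite /x trmxK trmx0.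
rewrite -[X in _ = X](@row_mx0 _ 1 n n) => /eq_row_mx[/= w1 w2].
rewrite (surjective_pairing w) w1 [w.2](_ : _ = 0)//.
by rewrite -[w.2]mulmx1 -PP mulmxA w2 mul0mx.
Qed.

(** A kernel vector yields a combination of the [a i] orthogonal to the whole frame, hence zero.
    This makes [invmx] in the Christoffel symbols a genuine inverse. *)
Lemma gram_unitmx : \matrix_(i, j) bform P (a i) (a j) \in unitmx.
Proof.
rewrite -row_free_unit; apply: inj_row_free => b bh; apply: a_free.
apply: frame_nondegenerate.
  by rewrite bform_suml big1// => i _; rewrite bformZl aN mulr0.
move=> j; move/rowP: bh => /(_ j); rewrite !mxE => <-.
by rewrite bform_suml; apply: eq_bigr => i _; rewrite bformZl mxE.
Qed.

End Frame.
End BilinearForm.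

(** * Parallel tensors on flat space *)

Section Geodesic.
Variable R : realType.

(** On constant fields [v] and [delta_mx 0 i] the condition says that row [i] of [phi] has zero
    derivative along [v]. So [phi] is constant on each line through the origin. *)
Lemma parallel_tensor_cst n (phi : 'rV[R]_n -> 'M[R]_n) :
  smooth_on setT phi -> parallel_tensor phi -> forall x, phi x = phi 0.
Proof.
move=> sphi pphi.
have smooth_cst (w : 'rV[R]_n) k : Ck_on k setT (cst w : 'rV[R]_n -> 'rV[R]_n).
  elim: k w => [w x _|k IH w] /=; first exact: cst_continuous.
  split=> [x _|v]; first exact: differentiable_cst.
  rewrite (_ : (fun x => _) = cst 0)//.
  by apply/funext => x; rewrite derive_cst.
have dphi x v : is_derive x v phi 0.
  apply: is_derive_mx => i j.
  have phix : derivable phi x v by apply: diff_derivable; exact: (sphi 1%N).1.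
  (* Without derivability, the equation [D0] on the value of the derivative would carry no
     information. *)
  have drow : derivable (fun y => delta_mx 0 i *m phi y : 'rV[R]_n) x v.
    apply/derivable_mxP => i' j'; rewrite ord1.
    rewrite [X in derivable X](_ : _ = fun y => phi y i j'); last first.
      by apply/funext => y; rewrite -rowE mxE.
    exact: (derivable_mxP phi x v).1.
  have := pphi (cst v) (cst (delta_mx 0 i)) (smooth_cst _) (smooth_cst _) x.
  rewrite /euclidean_nabla /tensor_app /= derive_cst mul0mx subr0 => D0.
  have := is_derive_mxE 0 j (derivableP drow); rewrite D0.
  by under eq_fun do rewrite -rowE mxE; rewrite !mxE.
move=> x; have dl (s : R) : [set: R] s ->
    is_derive s 1 (fun s : R => phi (0 + s *: x)) 0.
  by move=> _; apply: is_derive_line.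
have := is_derive0_itv_cst _ dl (s := 1) (t := 0).
by rewrite scale1r scale0r !add0r; apply.
Qed.

(** * Geodesics of a submanifold seen from the ambient space *)

Section Acceleration.
Variables (n k : nat) (P : 'M[R]_n).
Hypothesis Psym : forall X Y, dot (X *m P) Y = dot X (Y *m P).
Variables (U : set 'rV[R]_k) (F : 'rV[R]_k -> tanb R n).
Hypotheses (oU : open U) (sF : smooth_on U F).

Let a i u : tanb R n := 'D_(coord_vec R i) F u.
Let b i j u : tanb R n := 'D_(coord_vec R j) (a i) u.
Let h : 'rV[R]_k -> 'M[R]_k := induced_metric (fun=> bform P) F.

Let is_derive_F u v : U u -> is_derive u v F ('D_v F u).
Proof. by move=> Uu; apply/derivableP/diff_derivable; exact: (sF 1%N).1. Qed.

Let diff_a i u : U u -> differentiable (a i) u.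
Proof. by move=> Uu; exact: ((sF 2%N).2 _).1. Qed.

Let is_derive_a i u v : U u -> is_derive u v (a i) ('D_v (a i) u).
Proof. by move=> Uu; apply/derivableP/diff_derivable; exact: diff_a. Qed.

(** Symmetry of the second derivatives of [F], tested against a fixed [A] because [derive_commute]
    is scalar. *)
Let bC i j u A : U u -> bform P (b i j u) A = bform P (b j i u) A.
Proof.
move=> Uu.
apply: (derive_commute (f := fun u => bform P (F u) A)
  (fv := fun u => bform P (a i u) A) (fw := fun u => bform P (a j u) A)
  (fvw := fun u => bform P (b i j u) A) (fwv := fun u => bform P (b j i u) A)
  oU Uu).
- by move=> y Uy; apply: is_derive_bforml; exact: is_derive_F.
- by move=> y Uy; apply: is_derive_bforml; exact: is_derive_F.
- by move=> y Uy; apply: is_derive_bforml; exact: is_derive_a.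
- by move=> y Uy; apply: is_derive_bforml; exact: is_derive_a.
- by apply: continuous_bforml; exact: (((sF 2%N).2 _).2 _ _ Uu).
- by apply: continuous_bforml; exact: (((sF 2%N).2 _).2 _ _ Uu).
Qed.

Let derive_h s i j u : U u -> 'D_(coord_vec R s) (fun w => h w i j : R^o) u
  = bform P (b i s u) (a j u) + bform P (a i u) (b j s u).
Proof.
move=> Uu; under eq_fun do rewrite mxE.
have D := is_derive_bform P (is_derive_a i (coord_vec R s) Uu)
  (is_derive_a j (coord_vec R s) Uu).
exact: (@derive_val _ _ _ _ _ _ _ D).
Qed.

(* l-th coordinate of the tangential part of the ambient second derivative
   b i j u of the parametrization. *)
Lemma christoffelE l i j u : U u ->
  christoffel h u l i j = \sum_s invmx (h u) l s * bform P (b i j u) (a s u).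
Proof.
move=> Uu; rewrite /christoffel mulr_sumr; apply: eq_bigr => s _.
(* The product rule gives six terms. By symmetry of second derivatives [p2] cancels [p5], [p4]
   cancels [p6], and [p1 + p3] is twice [p3]. *)
have koszul (q p1 p2 p3 p4 p5 p6 : R) : p1 = p3 -> p2 = p5 -> p4 = p6 ->
    2^-1 * (q * (p1 + p2 + (p3 + p4) - (p5 + p6))) = q * p3.
  by move=> -> -> ->; field.
rewrite !derive_h//; apply: koszul; first exact: bC.
  exact: etrans (bformC Psym _ _) (bC _ _ _ Uu).
exact: etrans (bformC Psym _ _) (etrans (bC _ _ _ Uu) (bformC Psym _ _)).
Qed.

(** The ambient acceleration is the sum of the [c''_i a_i] and the [c'_i c'_j b_ij]. By
    [christoffelE] the geodesic equation makes the first sum minus the tangential part of the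
    second. *)
Lemma acceleration_orthogonal (J : set R) (c : R -> 'rV[R]_k)
    (Gam' : R -> tanb R n) t (w : tanb R n) :
  open J -> J t -> smooth_on (J : set R^o) c -> (forall s, J s -> U (c s)) ->
  (forall s, J s -> is_derive s 1 (F \o c) (Gam' s)) ->
  is_derive t 1 Gam' w ->
  h (c t) \in unitmx ->
  cov_deriv_along h c (derive1 c) t = 0 ->
  forall r, bform P w (a r (c t)) = 0.
Proof.
move=> oJ Jt sc Uc dG dG' hU geo r.
have dc s (Js : J s) := is_derive_derive1 sc Js.
have dc' := is_derive_derive2 sc Jt.
(* The test vector is frozen at time [t], so differentiating [GA] in [s] does not differentiate
   it. *)
set A := a r (c t).
have GA s : J s -> bform P (Gam' s) A
    = \sum_i derive1 c s 0 i * bform P (a i (c s)) A.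
  move=> Js; have dFcs : differentiable F (c s) by apply: (sF 1%N).1; exact: Uc.
  have E := is_derive_curve dFcs (dc s Js).
  rewrite -(@derive_val _ _ _ _ _ _ _ (dG s Js)) (@derive_val _ _ _ _ _ _ _ E).
  by rewrite derive_basis// bform_suml; apply: eq_bigr => i _; rewrite bformZl.
have wA : bform P w A = \sum_i (derive1 (derive1 c) t 0 i * bform P (a i (c t)) A
    + derive1 c t 0 i * \sum_j derive1 c t 0 j * bform P (b i j (c t)) A).
  have D1 := is_derive_bforml P A dG'.
  have D2 : is_derive t 1
    (fun s => \sum_i derive1 c s 0 i * bform P (a i (c s)) A : R^o)
    (\sum_i (derive1 (derive1 c) t 0 i * bform P (a i (c t)) A
    + derive1 c t 0 i * \sum_j derive1 c t 0 j * bform P (b i j (c t)) A)).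
    apply: is_derive_sum_fct => i; apply: is_derive_mul; first exact: is_derive_mxE.
    have := is_derive_bforml P A (is_derive_curve (diff_a i (Uc _ Jt)) (dc t Jt)).
    move/is_derive_eq; apply.
    rewrite derive_basis ?bform_suml; last exact/diff_a/Uc.
    by apply: eq_bigr => j _; rewrite bformZl.
  rewrite -(@derive_val _ _ _ _ _ _ _ D1) -(@derive_val _ _ _ _ _ _ _ D2).
  apply: near_eq_derive; near=> s; apply: GA.
  by near: s; exact: open_nbhs_nbhs.
have c'' l : derive1 (derive1 c) t 0 l = - \sum_s invmx (h (c t)) l s *
    \sum_i \sum_j derive1 c t 0 i * derive1 c t 0 j *
      bform P (b i j (c t)) (a s (c t)).
  move/rowP: geo => /(_ l); rewrite !mxE => /eqP; rewrite addr_eq0 => /eqP ->.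
  congr (- _).
  transitivity (\sum_i \sum_j \sum_s invmx (h (c t)) l s *
      (derive1 c t 0 i * derive1 c t 0 j * bform P (b i j (c t)) (a s (c t)))).
    apply: eq_bigr => i _; apply: eq_bigr => j _.
    rewrite christoffelE; last exact: Uc.
    by rewrite !mulr_suml; apply: eq_bigr => s _; ring.
  under eq_bigr do rewrite exchange_big; rewrite exchange_big/=.
  apply: eq_bigr => s _; rewrite mulr_sumr; apply: eq_bigr => i _.
  by rewrite mulr_sumr.
(* The quadratic velocity term with lowered index. As [c''] is minus the inverse Gram matrix times
   [Y], lowering its index returns [- Y]. *)
pose Y := \col_s (\sum_i \sum_j derive1 c t 0 i * derive1 c t 0 j *
      bform P (b i j (c t)) (a s (c t))).
have hY : \sum_i derive1 (derive1 c) t 0 i * bform P (a i (c t)) A = - Y r 0.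
  have hE l : h (c t) r l = bform P (a l (c t)) A.
    by rewrite mxE; exact: bformC.
  rewrite -[Y in RHS](mulKVmx hU) mxE -sumrN; apply: eq_bigr => l _.
  rewrite c'' -hE mulNr mulrC; congr (- (_ * _)); rewrite mxE.
  by apply: eq_bigr => s _; congr (_ * _); rewrite mxE.
have opp_add0 (x y z : R) : x = - z -> y = z -> x + y = 0.
  by move=> -> ->; rewrite addNr.
rewrite wA big_split; apply: (opp_add0 _ _ _ hY); rewrite [RHS]mxE.
apply: eq_bigr => i _; rewrite mulr_sumr; apply: eq_bigr => j _.
by rewrite mulrA.
Unshelve. all: by end_near. Qed.

End Acceleration.
End Geodesic.

(** * Equations of motion on the unit bundle and their solutions *)

Section UnitBundle.
Variable R : realType.

Section Equation.
Variables (n k : nat) (P : 'M[R]_n).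
Hypothesis PP : P *m P = 1%:M.
Hypothesis Psym : forall X Y, dot (X *m P) Y = dot X (Y *m P).
Hypothesis dim : k.+1 = (n + n)%N.

(** By symmetry of [P] the derivative of the constant [dot X (X *m P)] is twice the claimed product.
    A general [V] serves both the parametrization and the curve [xi]. *)
Lemma dot_cst_orthogonal (V : normedModType R) (U : set V) (X : V -> 'rV[R]_n)
    u v dX : open U -> U u ->
  (forall y, U y -> dot (X y) (X y *m P) = 1) -> is_derive u v X dX ->
  dot dX (X u *m P) = 0.
Proof.
move=> oU Uu X1 dXu.
have D1 := is_derive_dot dXu (is_derive_mulmx P dXu).
have D2 : is_derive u v (fun y => dot (X y) (X y *m P) : R^o) 0.
  apply: (near_eq_is_derive _ (is_derive_cst (1 : R^o) u v)).
  by near=> y; rewrite X1//; near: y; exact: open_nbhs_nbhs.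
have := @derive_val _ _ _ _ _ _ _ D1; rewrite (@derive_val _ _ _ _ _ _ _ D2).
rewrite -Psym [dot (X u) _]dotC => /esym/eqP.
by rewrite -mulr2n mulrn_eq0/= => /eqP.
Unshelve. all: by end_near. Qed.

Lemma tangent_frame (U : set 'rV[R]_k) (F : 'rV[R]_k -> tanb R n) u :
  local_parametrization (phi_unit_bundle (fun=> P)) U F -> U u ->
  [/\ bform P (0, (F u).2) (0, (F u).2) = 1,
      forall i, bform P ('D_(coord_vec R i) F u) (0, (F u).2) = 0 &
      forall b : 'rV_k, \sum_i b 0 i *: 'D_(coord_vec R i) F u = 0 -> b = 0].
Proof.
move=> [oU sF FS _ Finj] Uu.
have dFu : differentiable F u by exact: (sF 1%N).1.
split=> [|i|b].
- by rewrite bform_vertical /=; exact: FS.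
- rewrite bform_vertical /=; apply: (dot_cst_orthogonal oU Uu FS).
  by apply: is_derive_snd; apply/derivableP/diff_derivable.
- rewrite -derive_basis// deriveE// => db0.
  by apply: (Finj _ Uu); rewrite db0 linear0.
Qed.

Lemma geodesic_normal_acceleration (I : set R) (gam xi : R -> 'rV[R]_n) t :
  smooth_on (I : set R^o) gam -> smooth_on (I : set R^o) xi ->
  geodesic_on k (sasaki (fun=> P)) (phi_unit_bundle (fun=> P)) I
    (fun t => (gam t, xi t) : tanb R n) -> I t ->
  derive1 (derive1 gam) t = 0 /\
  derive1 (derive1 xi) t = dot (derive1 (derive1 xi) t) (xi t *m P) *: xi t.
Proof.
move=> sgam sxi geo It.
have [U [F [J [c [locF [oJ Jt JI] sc Gc cov]]]]] := geo t It.
have [Uct FctE] := Gc t Jt.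
have [oU sF _ _ _] := locF.
have [NN aN afree] := tangent_frame locF Uct.
pose w : tanb R n := (derive1 (derive1 gam) t, derive1 (derive1 xi) t).
have dG s : J s -> is_derive s 1 (F \o c) ((derive1 gam s, derive1 xi s) : tanb R n).
  move=> Js; apply: (near_eq_is_derive (f := fun s => (gam s, xi s) : tanb R n)).
    near=> r; apply: (Gc _ _).2; near: r; exact: open_nbhs_nbhs.
  by apply: is_derive_pair; exact: is_derive_derive1 (JI _ Js).
have dG' : is_derive t 1 (fun s => (derive1 gam s, derive1 xi s) : tanb R n) w.
  by apply: is_derive_pair; exact: is_derive_derive2 It.
have wa := acceleration_orthogonal Psym oU sF oJ Jt sc (fun s Js => (Gc s Js).1)
  dG dG' (gram_unitmx PP Psym dim NN aN afree) (cov t Jt).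
set N : tanb R n := (0, (F (c t)).2) in NN aN.
(* Removing the normal component of [w] leaves a vector orthogonal to the full frame. *)
have w0 : w + (- bform P w N) *: N = 0.
  apply: (frame_nondegenerate PP Psym dim NN aN afree).
    by rewrite bformDl bformZl NN mulr1 subrr.
  move=> i; rewrite bformDl bformZl wa add0r.
  by rewrite (etrans (bformC Psym _ _) (aN i)) mulr0.
have wN : bform P w N = dot (derive1 (derive1 xi) t) (xi t *m P).
  by rewrite /N -FctE; exact: bform_vertical.
move/eqP: w0; rewrite scaleNr subr_eq0 wN /N -FctE => /eqP wE.
(* [N] has zero horizontal component, so comparing components gives both equations. *)
have vertical_scale (l : R) (x y z : 'rV[R]_n) :
    (y, z) = l *: ((0, x) : tanb R n) -> y = 0 /\ z = l *: x.
  move=> E; split; first by rewrite -(scaler0 _ l); exact: (congr1 fst E).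
  exact: (congr1 snd E).
exact: vertical_scale wE.
Unshelve. all: by end_near. Qed.

End Equation.

(** Rotating the phase vector [(x, x' / rho)] back by the angle [rho * t] gives the conserved pair
    [(u, v)]; rotating forward again recovers [x]. No uniqueness theorem for differential equations
    is invoked. *)
Lemma harmonic_oscillator n (I : set R) (rho : R) (x x' : R -> 'rV[R]_n) :
  is_interval I -> rho != 0 ->
  (forall t, I t -> is_derive t 1 x (x' t)) ->
  (forall t, I t -> is_derive t 1 x' (- rho ^+ 2 *: x t)) ->
  exists c3 c4, forall t, I t ->
    x t = cos (rho * t) *: c3 + sin (rho * t) *: c4.
Proof.
move=> hI rho0 dx dx'.
have [[t0 It0]|] := pselect (exists t, I t); last first.
  by move=> noI; exists 0, 0 => t It; exfalso; apply: noI; exists t.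
have drho (t : R) : is_derive t 1 (fun t => rho * t : R^o) rho.
  by have := is_deriveZ rho (is_derive_id t (1 : R^o)); rewrite [rho *: 1]mulr1.
have dcos (t : R) : is_derive t 1 (fun t => cos (rho * t) : R^o)
    (- rho * sin (rho * t)).
  apply: (is_derive_eq (is_derive1_comp (is_derive_cos _) (drho t))).
  by rewrite mulrC mulrN mulNr.
have dsin (t : R) : is_derive t 1 (fun t => sin (rho * t) : R^o)
    (rho * cos (rho * t)).
  apply: (is_derive_eq (is_derive1_comp (is_derive_sin _) (drho t))).
  by rewrite mulrC.
pose u t := \row_j (cos (rho * t) * x t 0 j - rho^-1 * (sin (rho * t) * x' t 0 j)).
pose v t := \row_j (sin (rho * t) * x t 0 j + rho^-1 * (cos (rho * t) * x' t 0 j)).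
have du t : I t -> is_derive t 1 u 0.
  move=> It; apply: is_derive_mx => i j; rewrite ord1.
  rewrite /u; under eq_fun do rewrite mxE.
  have D := is_deriveB
    (is_derive_mul (dcos t) (is_derive_mxE 0 j (dx t It)))
    (is_deriveZ rho^-1 (is_derive_mul (dsin t) (is_derive_mxE 0 j (dx' t It)))).
  apply: (is_derive_eq D); rewrite !mxE /GRing.scale /=.
  by field.
have dv t : I t -> is_derive t 1 v 0.
  move=> It; apply: is_derive_mx => i j; rewrite ord1.
  rewrite /v; under eq_fun do rewrite mxE.
  have D := is_deriveD
    (is_derive_mul (dsin t) (is_derive_mxE 0 j (dx t It)))
    (is_deriveZ rho^-1 (is_derive_mul (dcos t) (is_derive_mxE 0 j (dx' t It)))).
  apply: (is_derive_eq D); rewrite !mxE /GRing.scale /=.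
  by field.
exists (u t0), (v t0) => t It.
rewrite (is_derive0_itv_cst hI du It0 It) (is_derive0_itv_cst hI dv It0 It).
apply/rowP => j; rewrite !mxE.
rewrite -[LHS]mul1r -(cos2Dsin2 (rho * t)); ring.
Qed.

Lemma affine_of_derive2_eq0 n (I : set R) (x x' : R -> 'rV[R]_n) :
  is_interval I -> (forall t, I t -> is_derive t 1 x (x' t)) ->
  (forall t, I t -> is_derive t 1 x' 0) ->
  exists c1 c2, forall t, I t -> x t = t *: c1 + c2.
Proof.
move=> hI dx dx'.
have [[t0 It0]|] := pselect (exists t, I t); last first.
  by move=> noI; exists 0, 0 => t It; exfalso; apply: noI; exists t.
(* The constant velocity, and the constant value of [x s - s *: x' t0] read at [t0]. *)
exists (x' t0), (x t0 - t0 *: x' t0) => t It.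
have dy s : I s -> is_derive s 1 (fun s => x s - s *: x' t0) 0.
  move=> Is; have dscale : is_derive s 1 (fun s => s *: x' t0) (x' t0).
    apply: is_derive_mx => i j.
    rewrite [X in is_derive _ _ X](_ : _ = fun s => s * x' t0 i j); last first.
      by apply/funext => r; rewrite mxE.
    have := is_derive_mul (is_derive_id s (1 : R^o))
      (is_derive_cst (x' t0 i j : R^o) s 1).
    by move/is_derive_eq; apply; rewrite mulr0 addr0 mul1r.
  apply: (is_derive_eq (is_deriveB (dx s Is) dscale)).
  by rewrite (is_derive0_itv_cst hI dx' Is It0) subrr.
have := is_derive0_itv_cst hI dy It0 It => /= ->.
by rewrite addrC subrK.
Qed.

End UnitBundle.

(** * The shape of oblique geodesics *)

Theorem theorem4p12 (R : realType) (m : nat)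
    (phi : 'rV[R]_(2 * m) -> 'M[R]_(2 * m))
    (hphi : para_kahler_norden phi)
    (I : set R) (hIopen : open I) (hI : is_interval I)
    (gam xi : R -> 'rV[R]_(2 * m)) (rho : R)
    (hgeo : unit_bundle_geodesic phi I gam xi)
    (hnat : naturally_parametrized phi I gam xi)
    (hobl : oblique phi I rho gam xi) :
  exists c1 c2 c3 c4 : 'rV[R]_(2 * m), forall t, I t ->
    gam t = t *: c1 + c2 /\
    xi t = cos (rho * t) *: c3 + sin (rho * t) *: c4.
Proof.
case: hphi => sphi invphi phi1 _ _ symphi parphi.
have phiE : phi = fun=> phi 0.
  by apply/funext => x; rewrite (parallel_tensor_cst sphi parphi x).
move: (phi 0) (invphi 0) (symphi 0) phiE => P PP Psym phiE; subst phi.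
(* In dimension zero every matrix is the identity, contrary to [phi1]. Positivity makes the
   predecessor in [(4 * m).-1] the true hypersurface dimension. *)
have m_gt0 : (0 < m)%N.
  rewrite lt0n; apply/eqP => m0; apply: phi1; apply/funext => x.
  by apply/matrixP => i; have := ltn_ord i; lia.
have dim : ((4 * m).-1).+1 = (2 * m + 2 * m)%N by lia.
have [sgam sxi xi1 geo] := hgeo.
have [/andP[rho_gt0 _] hrho] := hobl.
have acc t := geodesic_normal_acceleration PP Psym dim sgam sxi geo (t := t).
have dgam t (It : I t) := is_derive_derive1 sgam It.
have dxi t (It : I t) := is_derive_derive1 sxi It.
have xi'xi t : I t -> dot (derive1 xi t) (xi t *m P) = 0.
  by move=> It; exact: dot_cst_orthogonal hIopen It xi1 (dxi t It).
(* Differentiating [xi'xi], valid near [t] since [I] is open, gives minus the vertical energy of the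
   velocity, which obliqueness fixes as [rho ^+ 2]. *)
have lam t : I t -> dot (derive1 (derive1 xi) t) (xi t *m P) = - rho ^+ 2.
  move=> It; have D1 := is_derive_dot (is_derive_derive2 sxi It)
    (is_derive_mulmx P (dxi t It)).
  have D2 : is_derive t 1 (fun t => dot (derive1 xi t) (xi t *m P) : R^o) 0.
    apply: (near_eq_is_derive _ (is_derive_cst (0 : R^o) t 1)).
    by near=> s; rewrite xi'xi//; near: s; exact: open_nbhs_nbhs.
  have := @derive_val _ _ _ _ _ _ _ D1; rewrite (@derive_val _ _ _ _ _ _ _ D2).
  by rewrite (hrho t It).2 => /esym/eqP; rewrite addr_eq0 => /eqP.
have [c1 [c2 gamE]] : exists c1 c2, forall t, I t -> gam t = t *: c1 + c2.
  apply: affine_of_derive2_eq0 hI dgam _ => t It.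
  by rewrite -(acc t It).1; exact: is_derive_derive2 It.
have [c3 [c4 xiE]] : exists c3 c4, forall t, I t ->
    xi t = cos (rho * t) *: c3 + sin (rho * t) *: c4.
  apply: harmonic_oscillator hI _ dxi _ => [|t It]; first by rewrite gt_eqF.
  by rewrite -(lam t It) -(acc t It).2; exact: is_derive_derive2 It.
by exists c1, c2, c3, c4 => t It; split; [exact: gamE | exact: xiE].
Unshelve. all: by end_near. Qed.
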